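(* Let $F_1(q)=\sum_{n\ge 0}f_1(n)q^n$ be the generating function of the number of $1$-convex permutations by length (with $f_1(0)=1$). Then, as formal power series, $$F_1(q)=1+q-2q^2\,\frac{1+\mathrm{bot}(q)\,q^2+\mathrm{tot}(q)\,q}{-1+q+\mathrm{bot}(q)\,q^3},$$ where $\mathrm{bot}(q)$ and $\mathrm{tot}(q)$ are the generating functions by length of the walks in the digraph $T$ from the root $v_1$ to $v_1$, and of all the walks in $T$ starting at $v_1$, respectively.
   Context: A permutation $\pi:[n]\to[n]$, where $[n]=\{1,\ldots,n\}$, is $1$-convex if $\pi(i-1)+\pi(i+1)-2\pi(i)\le 1$ for all $i\in\{2,\ldots,n-1\}$; $f_1(n)$ is the number of $1$-convex permutations of length $n$. The infinite digraph $T$ has main vertices $v_1,v_2,v_3,\ldots$ (in the paper $v_l$ is the node written $12(l+1)(l+2)$, so $v_1=1223$, $v_2=1234$, $v_3=1245$, and so on). For each $l\ge 1$ there is one edge $v_l\to v_{l+1}$, and there is a directed path with exactly $l+2$ edges from $v_{l+1}$ to $v_l$, whose $l+1$ intermediate vertices are additional vertices of $T$ lying on no other edges (so the return path $v_2\to v_1$ has $3$ edges, $v_3\to v_2$ has $4$ edges, $v_4\to v_3$ has $5$ edges, etc.). There are no other vertices or edges. The length of a walk is its number of edges; the empty walk (length $0$) is counted. Walks counted by $\mathrm{tot}(q)$ may end at any vertex of $T$, including the intermediate vertices of the return paths. *)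

(* Defs.v *)
From HB Require Import structures.
From mathcomp Require Import all_boot all_algebra all_fingroup.
From mathcomp Require Import finmap.
From mathcomp Require Import boolp classical_sets functions cardinality.

Set Implicit Arguments.
Unset Strict Implicit.
Unset Printing Implicit Defensive.

Import GRing.Theory.
Local Open Scope ring_scope.

(** * Formal power series over a commutative ring with units

    [fpsnth a n] is the coefficient of degree [n] of [a]. The product is the
    Cauchy product, and the units are the series with invertible constant
    coefficient; [a / b] below is the resulting division. *)

Record fps (R : Type) := Fps { fpsnth : nat -> R }.

Notation "{ 'fps' R }" := (fps R) (at level 0, format "{ 'fps'  R }").

HB.instance Definition _ (R : Type) := gen_eqMixin (fps R).
HB.instance Definition _ (R : Type) := gen_choiceMixin (fps R).

Lemma fpsP (R : Type) (a b : fps R) : fpsnth a =1 fpsnth b <-> a = b.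
Proof.
split=> [|-> //]; case: a b => [a] [b] /= ab.
by congr Fps; apply: funext.
Qed.

Section FpsRing.
Context {R : comNzRingType}.
Implicit Types a b c : fps R.

Definition fps_zero : fps R := Fps (fun=> 0).
Definition fps_opp a : fps R := Fps (fun n => - fpsnth a n).
Definition fps_add a b : fps R := Fps (fun n => fpsnth a n + fpsnth b n).

Fact fps_addA : associative fps_add.
Proof. by move=> a b c; apply/fpsP => n /=; rewrite addrA. Qed.
Fact fps_addC : commutative fps_add.
Proof. by move=> a b; apply/fpsP => n /=; rewrite addrC. Qed.
Fact fps_add0 : left_id fps_zero fps_add.
Proof. by move=> a; apply/fpsP => n /=; rewrite add0r. Qed.
Fact fps_addN : left_inverse fps_zero fps_opp fps_add.
Proof. by move=> a; apply/fpsP => n /=; rewrite addNr. Qed.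

HB.instance Definition _ := GRing.isZmodule.Build (fps R)
  fps_addA fps_addC fps_add0 fps_addN.

Definition fps_one : fps R := Fps (fun n => (n == 0%N)%:R).
Definition fps_mul a b : fps R :=
  Fps (fun n => \sum_(i < n.+1) fpsnth a i * fpsnth b (n - i)).

Definition fps_trunc n a : {poly R} := \poly_(i < n.+1) fpsnth a i.

Lemma coef_fps_trunc n a k : (k <= n)%N -> (fps_trunc n a)`_k = fpsnth a k.
Proof. by move=> kn; rewrite coef_poly ltnS kn. Qed.

Lemma coef_fps_truncM n a b k : (k <= n)%N ->
  (fps_trunc n a * fps_trunc n b)`_k = fpsnth (fps_mul a b) k.
Proof.
move=> kn; rewrite coefM /=; apply: eq_bigr => i _.
rewrite !coef_fps_trunc //; first by rewrite (leq_trans (leq_subr _ _)).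
by rewrite (leq_trans _ kn) // -ltnS.
Qed.

Fact fps_mulC : commutative fps_mul.
Proof.
by move=> a b; apply/fpsP => n; rewrite -!(@coef_fps_truncM n) // mulrC.
Qed.

Fact fps_mulA : associative fps_mul.
Proof.
move=> a b c; apply/fpsP => n.
transitivity ((fps_trunc n a * fps_trunc n b * fps_trunc n c)`_n).
  rewrite -mulrA coefM /=; apply: eq_bigr => i _.
  by rewrite coef_fps_trunc -1?ltnS // coef_fps_truncM // leq_subr.
rewrite coefM /=; apply: eq_bigr => i _.
by rewrite coef_fps_truncM -1?ltnS // coef_fps_trunc // leq_subr.
Qed.

Fact fps_mul1 : left_id fps_one fps_mul.
Proof.
move=> a; apply/fpsP => n /=; rewrite big_ord_recl /= subn0 mul1r big1 ?addr0 //.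
by move=> i _; rewrite mul0r.
Qed.

Fact fps_mulDl : left_distributive fps_mul fps_add.
Proof.
move=> a b c; apply/fpsP => n /=; rewrite -big_split /=.
by apply: eq_bigr => i _; rewrite mulrDl.
Qed.

Fact fps_one_neq0 : fps_one != 0.
Proof. by apply/eqP => /fpsP /(_ 0%N) /eqP; rewrite /= oner_eq0. Qed.

HB.instance Definition _ := GRing.Zmodule_isComNzRing.Build (fps R)
  fps_mulA fps_mulC fps_mul1 fps_mulDl fps_one_neq0.

Definition fpsX : fps R := Fps (fun n => (n == 1%N)%:R).

Lemma fpsnthD a b n : fpsnth (a + b) n = fpsnth a n + fpsnth b n.
Proof. by []. Qed.
Lemma fpsnthN a n : fpsnth (- a) n = - fpsnth a n.
Proof. by []. Qed.
Lemma fpsnthM a b n :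
  fpsnth (a * b) n = \sum_(i < n.+1) fpsnth a i * fpsnth b (n - i).
Proof. by []. Qed.
Lemma fpsnth1 n : fpsnth (1 : fps R) n = (n == 0%N)%:R.
Proof. by []. Qed.
Lemma fpsnthX n : fpsnth fpsX n = (n == 1%N)%:R.
Proof. by []. Qed.

End FpsRing.

Arguments fpsX {R}.

Section FpsUnitRing.
Context {R : comUnitRingType}.
Implicit Types a b c : fps R.

Definition fps_unit : pred (fps R) := [pred a | fpsnth a 0 \is a GRing.unit].

(* The first [n] coefficients of the inverse of [a], determined in order by
   the vanishing of the positive-degree coefficients of [a * a^-1]. *)
Fixpoint fps_inv_seq a n : seq R :=
  if n is m.+1 then
    let s := fps_inv_seq a m in
    rcons s ((fpsnth a 0)^-1 *
             ((m == 0%N)%:R - \sum_(i < m) s`_i * fpsnth a (m - i)))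
  else [::].

Definition fps_inv a : fps R :=
  if fps_unit a then Fps (fun n => (fps_inv_seq a n.+1)`_n) else a.

Lemma size_fps_inv_seq a n : size (fps_inv_seq a n) = n.
Proof. by elim: n => //= n IHn; rewrite size_rcons IHn. Qed.

Lemma nth_fps_inv_seq a n i : (i < n)%N ->
  (fps_inv_seq a n)`_i = (fps_inv_seq a i.+1)`_i.
Proof.
elim: n => // n IHn; rewrite ltnS leq_eqVlt => /predU1P [-> //|lt_in].
by rewrite -IHn //= nth_rcons size_fps_inv_seq lt_in.
Qed.

Fact fps_mulV : {in fps_unit, left_inverse 1 fps_inv *%R}.
Proof.
move=> a Ua; apply/fpsP => n; rewrite fpsnthM /fps_inv (Ua : fps_unit a).
rewrite big_ord_recr /= subnn nth_rcons size_fps_inv_seq ltnn eqxx.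
rewrite mulrAC mulVr // mul1r addrC.
under [X in _ - X]eq_bigr => i _ do rewrite nth_fps_inv_seq //.
by rewrite subrK.
Qed.

Fact fps_unitP a b : b * a = 1 -> fps_unit a.
Proof.
move=> /fpsP /(_ 0%N); rewrite fpsnthM big_ord1 /= => ba1.
by apply/unitrPr; exists (fpsnth b 0); rewrite mulrC.
Qed.

Fact fps_inv_out : {in [predC fps_unit], fps_inv =1 id}.
Proof. by move=> a /negbTE Ua; rewrite /fps_inv [fps_unit a]Ua. Qed.

HB.instance Definition _ := GRing.ComNzRing_hasMulInverse.Build (fps R)
  fps_mulV fps_unitP fps_inv_out.

Lemma fps_unitE a : (a \is a GRing.unit) = (fpsnth a 0 \is a GRing.unit).
Proof. by []. Qed.

End FpsUnitRing.

Definition gf (u : nat -> nat) : {fps int} := Fps (fun n => (u n)%:R).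

(** * 1-convex permutations

    Positions and values run over [0, ..., n-1] instead of [1, ..., n]; this
    leaves the second differences unchanged. *)

Definition one_convex n (s : 'S_n) : bool :=
  [forall h : 'I_n, forall i : 'I_n, forall j : 'I_n,
    (i == h.+1 :> nat) && (j == i.+1 :> nat) ==>
      ((s h)%:Z + (s j)%:Z - 2 * (s i)%:Z <= 1)].

Definition f1 n : nat := #|[set s : 'S_n | one_convex s]|.

(** * Walks in a digraph

    A walk of length [n] from [u] is given by the sequence of its [n] vertices
    after [u]. [fset_set] has its intended meaning on finite sets only; see
    [finite_Twalks] for the digraph at hand. *)

Definition walks (V : Type) (E : rel V) (u : V) (n : nat) : set (seq V) :=
  [set p | path E u p /\ size p = n]%classic.

Definition walks_to (V : Type) (E : rel V) (u v : V) (n : nat) : set (seq V) :=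
  [set p | walks E u n p /\ last u p = v]%classic.

(** * The digraph T

    [Main l] is the vertex v_(l+1). [Mid l j], with [j < l + 2], is the [j]-th
    intermediate vertex on the return path, of [l + 3] edges, from v_(l+2) to
    v_(l+1), that is from [Main l.+1] to [Main l]. *)

Inductive Tvertex := Main (l : nat) | Mid (l : nat) (j : 'I_l.+2).

Definition Tvertex_code (x : Tvertex) : nat + {l : nat & 'I_l.+2} :=
  match x with
  | Main l => inl l
  | Mid l j => inr (Tagged (fun l => 'I_l.+2) j)
  end.

Definition Tvertex_decode (x : nat + {l : nat & 'I_l.+2}) : Tvertex :=
  match x with inl l => Main l | inr u => Mid (tagged u) end.

Fact Tvertex_codeK : cancel Tvertex_code Tvertex_decode.
Proof. by case. Qed.

HB.instance Definition _ := Countable.copy Tvertex (can_type Tvertex_codeK).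

Definition Tedge (x y : Tvertex) : bool :=
  match x, y with
  | Main l, Main m => m == l.+1
  | Main l, @Mid m j => (l == m.+1) && (j == 0%N :> nat)
  | @Mid l j, @Mid m k => (l == m) && (k == j.+1 :> nat)
  | @Mid l j, Main m => (l == m) && (j == l.+1 :> nat)
  end.

Definition Troot : Tvertex := Main 0.

Definition Tsucc (x : Tvertex) : seq Tvertex :=
  match x with
  | Main l => Main l.+1 :: (if l is m.+1 then [:: @Mid m ord0] else [::])
  | @Mid l j => [:: Main l; @Mid l (inord j.+1)]
  end.

Lemma TedgeS x y : Tedge x y -> y \in Tsucc x.
Proof.
case: x y => [l|l j] [m|m k] /=.
- by move/eqP->; rewrite mem_head.
- case/andP=> /eqP -> /eqP k0; rewrite !inE; apply/orP; right.
  by apply/eqP; congr Mid; apply: val_inj.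
- by case/andP=> /eqP <- _; rewrite mem_head.
- case/andP=> /eqP lm; case: m / lm k => k /eqP kj; rewrite !inE; apply/orP.
  right; apply/eqP; congr Mid; apply: val_inj.
  by rewrite /= inordK // -kj.
Qed.

Lemma finite_Twalks x n : finite_set (walks Tedge x n).
Proof.
suff [s sP] : exists s : seq (seq Tvertex),
    forall p, walks Tedge x n p -> p \in s.
  by apply: (sub_finite_set _ (finite_seq s)) => p /sP.
elim: n x => [|n IHn] x.
  by exists [:: [::]] => p [_ /size0nil ->].
have /choice [f fP] := IHn.
exists [seq y :: p | y <- Tsucc x, p <- f y] => -[|y p] [] //= /andP[xy yp] [sp].
by apply/allpairsPdep; exists y, p; split=> //; [apply: TedgeS | apply: fP].
Qed.

Lemma finite_Twalks_to x y n : finite_set (walks_to Tedge x y n).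
Proof. by apply: sub_finite_set (finite_Twalks x n) => p []. Qed.

Definition bot_count n : nat := #|` fset_set (walks_to Tedge Troot Troot n)|%fset.
Definition tot_count n : nat := #|` fset_set (walks Tedge Troot n)|%fset.

(* Main.v *)
Require Import Defs.
From mathcomp Require Import all_boot all_algebra.
From mathcomp Require Import all_fingroup finmap.
From mathcomp Require Import boolp classical_sets cardinality.
From mathcomp Require Import zify ring.

(* A 1-convex permutation has no interior local minimum, so it is obtained from
   its largest value by adding the smaller values in decreasing order, each at
   the left or at the right end. It is thus encoded by a word in two letters, and
   1-convexity says that, for each of the two letters, the gaps between
   consecutive occurrences (the end of the word counting as an occurrence of
   both) increase by at most 1 at a time. Hence a run of length at least 2 is
   followed by a run of length 1, which is followed by a run whose length exceeds
   that of the first by at most 1.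

   The generating functions [V_k] ([run_gf k]) of the continuations of a run of
   length [k]
   satisfy [V_(k+1) = V_k + q^(k+3) V_(k+2)], and [q^l V_(l+2)] satisfies the
   recurrence of the generating functions [P_l] of the walks from the root to the
   [l]-th main vertex of T, so that [V_1 P_l = q^l V_(l+2)]. In particular
   [V_1 bot = V_2], whence [V_1 (1 - q - q^3 bot) = 1]. Moreover
   [(1 - q) tot = 1 + q sum_(l >= 1) P_l], since a vertex of T has out-degree 2 if
   it is a main vertex other than the root, and 1 otherwise. *)

Set Implicit Arguments.
Unset Strict Implicit.
Unset Printing Implicit Defensive.

Import GRing.Theory.

(** * Counting words whose gaps grow slowly *)

(* A gap [0] stands for the absence of a previous gap. *)
Definition slow (x y : nat) := (x == 0) || (y <= x.+1).

(* The first gap is measured from the position preceding [w], and the end of [w]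
   counts as an occurrence of [c]. *)
Fixpoint gaps (c : bool) (w : seq bool) : seq nat :=
  if w is b :: w' then
    if b == c then 1 :: gaps c w'
    else (head 0 (gaps c w')).+1 :: behead (gaps c w')
  else [:: 1].

(** [behead] discards the initial gap, which does not start at an occurrence of the letter. *)
Definition slow_word w :=
  path slow 0 (behead (gaps true w)) && path slow 0 (behead (gaps false w)).

Fixpoint words n : seq (seq bool) :=
  if n is m.+1 then map (cons true) (words m) ++ map (cons false) (words m)
  else [:: [::]].

Lemma mem_words n w : (w \in words n) = (size w == n).
Proof.
elim: n w => [|n IHn] [|b w] //=.
- by rewrite mem_cat; apply/negbTE; rewrite negb_or; apply/andP; split;
    apply/mapP => -[].
- have inj c : injective (@cons bool c) by move=> ? ? [].
  rewrite mem_cat eqSS -IHn; case: b; rewrite mem_map //.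
  + by rewrite orbC; case: mapP => // -[].
  + by case: mapP => // -[].
Qed.

Lemma uniq_words n : uniq (words n).
Proof.
elim: n => //= n IHn.
have inj c : injective (@cons bool c) by move=> ? ? [].
rewrite cat_uniq !map_inj_uniq // IHn andbT /=.
by apply/hasPn => w /mapP[u _ ->]; apply/mapP => -[].
Qed.

Lemma count_wordsS P n :
  count P (words n.+1) =
    count (fun w => P (true :: w)) (words n) +
    count (fun w => P (false :: w)) (words n).
Proof. by rewrite /= count_cat !count_map. Qed.

Lemma gaps_cons c w : gaps c w = head 0 (gaps c w) :: behead (gaps c w).
Proof. by case: w => //= b w; case: eqP. Qed.

Lemma head_gaps_gt0 c w : 0 < head 0 (gaps c w).
Proof. by case: w => //= b w; case: eqP. Qed.

Lemma slow_1 x : slow x 1. Proof. by rewrite /slow; case: x. Qed.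

(* [c] is the last letter read and [v] its last gap; [p] is the last gap of the
   other letter, which occurred for the last time [t] letters ago. *)
Definition slow_after p t v c w :=
  path slow p (head 0 (gaps (~~ c) w) + t :: behead (gaps (~~ c) w)) &&
  path slow v (gaps c w).

Lemma slow_after_same p t v c w :
  slow_after p t v c (c :: w) = slow_after p t.+1 1 c w.
Proof.
rewrite /slow_after /= eqxx; case: c => /=; rewrite slow_1 ?andTb /=;
  by rewrite addSnnS.
Qed.

Lemma slow_after_other p t v c w :
  slow_after p t v c (~~ c :: w) = slow p t.+1 && slow_after v 1 t.+1 (~~ c) w.
Proof.
by rewrite /slow_after; case: c => /=; rewrite !addn1 add1n -andbA;
  congr (_ && _); rewrite andbC.
Qed.

Fixpoint cnt_after p t v n : nat :=
  if n is m.+1 then slow p t.+1 * cnt_after v 1 t.+1 m + cnt_after p t.+1 1 m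
  else slow p t.+1.

Lemma count_slow_after n p t v c :
  count (slow_after p t v c) (words n) = cnt_after p t v n.
Proof.
elim: n p t v c => [|n IHn] p t v c.
  by rewrite /= /slow_after /= slow_1 !andbT addn0 add1n.
have -> : count (slow_after p t v c) (words n.+1) =
    count (fun w => slow_after p t v c (~~ c :: w)) (words n) +
    count (fun w => slow_after p t v c (c :: w)) (words n).
  by rewrite count_wordsS; case: c; rewrite // addnC.
congr (_ + _); last by rewrite (eq_count (slow_after_same p t v c)) IHn.
rewrite (eq_count (slow_after_other p t v c)).
by case: slow; rewrite /= ?IHn ?mul1n // count_pred0.
Qed.

(* As [slow_after], but the other letter has not occurred yet. *)
Definition slow_first v c w :=
  path slow 0 (behead (gaps (~~ c) w)) && path slow v (gaps c w).

Fixpoint cnt_first v n : nat :=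
  if n is m.+1 then cnt_after v 1 0 m + cnt_first 1 m else 1.

Lemma slow_first_same v c w : slow_first v c (c :: w) = slow_first 1 c w.
Proof. by rewrite /slow_first /= eqxx; case: c; rewrite /= slow_1. Qed.

Lemma slow_first_other v c w :
  slow_first v c (~~ c :: w) = slow_after v 1 0 (~~ c) w.
Proof.
by rewrite /slow_first /slow_after; case: c => /=; rewrite andbC !addn1.
Qed.

Lemma count_slow_first n v c : count (slow_first v c) (words n) = cnt_first v n.
Proof.
elim: n v c => [|n IHn] v c.
  by rewrite /= /slow_first /= slow_1.
have -> : count (slow_first v c) (words n.+1) =
    count (fun w => slow_first v c (~~ c :: w)) (words n) +
    count (fun w => slow_first v c (c :: w)) (words n).
  by rewrite count_wordsS; case: c; rewrite // addnC.
rewrite (eq_count (slow_first_same v c)) (eq_count (slow_first_other v c)).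
by rewrite IHn count_slow_after.
Qed.

Lemma slow_word_cons c w : slow_word (c :: w) = slow_first 0 c w.
Proof. by rewrite /slow_word /slow_first; case: c => //=; rewrite andbC. Qed.

Lemma count_slow_word n : count slow_word (words n.+1) = (cnt_first 0 n).*2.
Proof.
rewrite count_wordsS (eq_count (slow_word_cons true)).
by rewrite (eq_count (slow_word_cons false)) !count_slow_first addnn.
Qed.

(** * Encoding of 1-convex sequences by words *)

Definition one_convex_seq (s : seq nat) :=
  all (fun i => nth 0 s i + nth 0 s i.+2 <= (nth 0 s i.+1).*2.+1)
    (iota 0 (size s - 2)).

Lemma one_convex_seqP s :
  reflect (forall i, i.+2 < size s ->
             nth 0 s i + nth 0 s i.+2 <= (nth 0 s i.+1).*2.+1)
          (one_convex_seq s).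
Proof.
apply: (iffP allP) => H i; last by rewrite mem_iota => ?; apply: H; lia.
by move=> ?; apply: H; rewrite mem_iota; lia.
Qed.

Lemma one_convex_seq_cons a s :
  one_convex_seq (a :: s) =
  ((1 < size s) ==> (a + nth 0 s 1 <= (nth 0 s 0).*2.+1)) && one_convex_seq s.
Proof.
apply/one_convex_seqP/andP => [H|[/implyP H0 /one_convex_seqP H] [|i]] /=.
- split; first by apply/implyP => ?; apply: (H 0).
  by apply/one_convex_seqP => i ?; apply: (H i.+1).
- exact: H0.
- exact: H.
Qed.

Lemma one_convex_seq_mapS s : one_convex_seq (map S s) = one_convex_seq s.
Proof.
apply/one_convex_seqP/one_convex_seqP; rewrite size_map => H i lt_i;
  by have := H i lt_i; rewrite !(nth_map 0) //; lia.
Qed.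

Lemma one_convex_seq_rev s : one_convex_seq (rev s) = one_convex_seq s.
Proof.
suff imp u : one_convex_seq u -> one_convex_seq (rev u).
  by apply/idP/idP => /imp //; rewrite revK.
move=> /one_convex_seqP H; apply/one_convex_seqP => i; rewrite size_rev => lt_i.
have := H (size u - i.+3); rewrite !nth_rev; try lia.
have -> : size u - i.+2 = (size u - i.+3).+1 by lia.
have -> : size u - i.+1 = (size u - i.+3).+2 by lia.
move/(_ _); lia.
Qed.

(* The [i]-th letter tells whether the value [i] lies to the left ([true]) or to
   the right of the maximum. *)
Fixpoint seq_of_word (w : seq bool) : seq nat :=
  match w with
  | [::] => [:: 0]
  | true :: w' => 0 :: map S (seq_of_word w')
  | false :: w' => rcons (map S (seq_of_word w')) 0
  end.

Lemma size_seq_of_word w : size (seq_of_word w) = (size w).+1.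
Proof. by elim: w => [|[] w IHw] //=; rewrite ?size_rcons size_map IHw. Qed.

Lemma seq_of_word_negb w : seq_of_word (map negb w) = rev (seq_of_word w).
Proof.
elim: w => [|[] w IHw] //=; rewrite IHw map_rev.
  by rewrite rev_cons.
by rewrite rev_rcons.
Qed.

Lemma gaps_negb c w : gaps c (map negb w) = gaps (~~ c) w.
Proof. by elim: w => //= b w ->; case: b c => -[]. Qed.

Lemma perm_seq_of_word w : perm_eq (seq_of_word w) (iota 0 (size w).+1).
Proof.
elim: w => [|b w IHw] //.
have -> : iota 0 (size (b :: w)).+1 = 0 :: map S (iota 0 (size w).+1).
  by rewrite -[RHS]/(0 :: map (addn 1) _) -iotaDl.
move: (iota 0 _) IHw => s /(perm_map succn).
by case: b; rewrite /= ?perm_rcons perm_cons.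
Qed.

Lemma seq_of_word_le w i : nth 0 (seq_of_word w) i <= size w.
Proof.
have [lt_i|le_i] := ltnP i (size (seq_of_word w)); last by rewrite nth_default.
have := mem_nth 0 lt_i.
by rewrite (perm_mem (perm_seq_of_word w)) mem_iota.
Qed.

(** When 0 is put in front, the only new condition bears on the first two entries [a], [b] of the
    old sequence. With [a.+1 = g] and [b.+1 = g + y] it reads [y <= g.+1]. *)
Lemma seq_of_word_gaps w :
  (nth 0 (seq_of_word w) 0).+1 = head 0 (gaps true w) /\
  if behead (gaps true w) is y :: _
  then (nth 0 (seq_of_word w) 1).+1 = head 0 (gaps true w) + y /\ 0 < size w
  else head 0 (gaps true w) = (size w).+1.
Proof.
elim: w => [|b w [IH0 IH1]] //.
have sz := size_seq_of_word w.
case: b => /=.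
  rewrite [gaps true w]gaps_cons /= (nth_map 0) ?sz // IH0.
  by rewrite add1n.
rewrite !nth_rcons size_map sz (nth_map 0) ?sz //= IH0; split=> //.
case: (behead _) IH1 => [->|y _ [E lt0]] //.
by rewrite ltnS lt0 (nth_map 0) ?sz ?ltnS // E addSn.
Qed.

Lemma path_slow0_behead x s :
  path slow x s = (if s is y :: _ then slow x y else true) && path slow 0 s.
Proof. by case: s => //= y s. Qed.

Lemma one_convex_seq_of_word w : one_convex_seq (seq_of_word w) = slow_word w.
Proof.
(* Only insertion at the left end is computed; insertion at the right end follows by exchanging the
   letters, which reverses the sequence. *)
have step u : one_convex_seq (seq_of_word u) = slow_word u ->
    one_convex_seq (seq_of_word (true :: u)) = slow_word (true :: u).
  move=> IH; rewrite /= one_convex_seq_cons one_convex_seq_mapS IH.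
  have -> : slow_word (true :: u) =
      (if behead (gaps true u) is y :: _
       then slow (head 0 (gaps true u)) y else true) && slow_word u.
    rewrite slow_word_cons /slow_first.
    have -> : path slow 0 (gaps true u) =
        path slow (head 0 (gaps true u)) (behead (gaps true u)).
      by rewrite {1}gaps_cons.
    by rewrite [path _ (head _ _) _]path_slow0_behead andbC -andbA.
  congr (_ && _).
  have [] := seq_of_word_gaps u; have sz := size_seq_of_word u.
  have gt0 := head_gaps_gt0 true u; have le1 := seq_of_word_le u 1.
  rewrite size_map sz /slow.
  case: (behead _) => [|y s] E0 E1.
    case: ltnP => //= ?; rewrite !(nth_map 0) ?sz //; lia.
  case: E1 => E1 lt0; rewrite ltnS lt0 /= !(nth_map 0) ?sz //; lia.
elim: w => [|[] w IH] //; first exact: step.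
have -> : false :: w = map negb (true :: map negb w).
  by rewrite /= -map_comp (eq_map negbK) map_id.
have negE u : slow_word (map negb u) = slow_word u.
  by rewrite /slow_word !gaps_negb andbC.
rewrite seq_of_word_negb one_convex_seq_rev negE step //.
by rewrite seq_of_word_negb one_convex_seq_rev negE.
Qed.

(** The first letter is [true] exactly when a nonempty word yields a sequence starting with 0. *)
Lemma seq_of_word_inj u w :
  size u = size w -> seq_of_word u = seq_of_word w -> u = w.
Proof.
have ends b v : nth 0 (seq_of_word (b :: v)) 0 = if b then 0 else
    (nth 0 (seq_of_word v) 0).+1.
  case: b => //=; rewrite nth_rcons size_map size_seq_of_word /=.
  by rewrite (nth_map 0) ?size_seq_of_word.
elim: u w => [|b u IHu] [|c w] //= [sz] E.
have bc : b = c.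
  have /(congr1 (fun s => nth 0 s 0)) : seq_of_word (b :: u) =
    seq_of_word (c :: w) by [].
  by rewrite !ends; case: b c {E} => -[].
rewrite -bc in E *; congr (_ :: _); apply: IHu => //.
apply: (inj_map succn_inj); case: b E {bc} => [[]//|].
by move/(congr1 (take (size (seq_of_word u)))); rewrite -!cats1 !take_cat
  !size_map !size_seq_of_word sz ltnn subnn !take0 !cats0.
Qed.

(* An entry between two larger entries violates convexity, so the least value
   stands at one of the two ends. *)
Lemma one_convex_seq_word n s :
  perm_eq s (iota 0 n.+1) -> one_convex_seq s ->
  exists2 w, size w = n & s = seq_of_word w.
Proof.
elim: n s => [|n IHn] s s_iota s_cvx.
  exists [::] => //; have := perm_size s_iota.
  case: s s_iota {s_cvx} => [|x []] // /perm_mem /(_ 0) /[!inE].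
  by rewrite eq_sym => /eqP ->.
have sz : size s = n.+2 by rewrite (perm_size s_iota) size_iota.
have s_uniq : uniq s by rewrite (perm_uniq s_iota) iota_uniq.
have shrink r : perm_eq (0 :: r) (iota 0 n.+2) ->
    one_convex_seq r -> exists2 w, size w = n & r = map S (seq_of_word w).
  have -> : iota 0 n.+2 = 0 :: map S (iota 0 n.+1).
    by rewrite -[RHS]/(0 :: map (addn 1) _) -iotaDl.
  rewrite perm_cons => r_iota r_cvx.
  have rE : r = map S (map predn r).
    rewrite -map_comp -[LHS]map_id; apply/eq_in_map => x.
    by rewrite (perm_mem r_iota) => /mapP[y _ ->].
  move: r_iota r_cvx; rewrite {1 2}rE one_convex_seq_mapS.
  move/(perm_map_inj succn_inj) => /IHn /[apply] -[w sw pE].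
  by exists w; rewrite // rE pE.
have : 0 \in s by rewrite (perm_mem s_iota) mem_iota.
case/(nthP 0) => i lt_i s_i0.
have gt0 j : j < size s -> j != i -> 0 < nth 0 s j.
  by move=> lt_j; rewrite -(nth_uniq 0 lt_j lt_i) // s_i0 lt0n.
case: i lt_i s_i0 gt0 => [|i] lt_i s_i0 gt0.
  case: s {lt_i gt0 s_uniq} sz s_iota s_cvx s_i0 => // x r _ r_iota.
  rewrite one_convex_seq_cons => /andP[_ r_cvx] /= x0; rewrite x0 in r_iota *.
  have [w sw ->] := shrink r r_iota r_cvx.
  by exists (true :: w); rewrite /= ?sw.
have [lt_i2|le_i2] := ltnP i.+2 (size s).
  move/one_convex_seqP: s_cvx => /(_ i lt_i2); rewrite s_i0.
  have := gt0 i (ltnW lt_i); have := gt0 i.+2 lt_i2; lia.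
case/lastP: s sz s_iota s_cvx s_i0 {s_uniq gt0} lt_i le_i2 => // r x.
rewrite size_rcons nth_rcons => -[sz] r_iota r_cvx r_i0 lt_i le_i2.
have iE : i.+1 = size r by lia.
move: r_i0; rewrite iE ltnn eqxx => x0; rewrite x0 in r_iota r_cvx *.
rewrite perm_rcons in r_iota.
have [|w sw ->] := shrink r r_iota; last first.
  by exists (false :: w); rewrite /= ?sw.
move: r_cvx; rewrite -one_convex_seq_rev rev_rcons one_convex_seq_cons.
by rewrite one_convex_seq_rev => /andP[].
Qed.

(** * From permutations to sequences and words *)

Definition perm_seq n (s : 'S_n) : seq nat := [seq val (s i) | i <- enum 'I_n].

Lemma size_perm_seq n (s : 'S_n) : size (perm_seq s) = n.
Proof. by rewrite size_map size_enum_ord. Qed.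

Lemma nth_perm_seq n (s : 'S_n) (i : 'I_n) : nth 0 (perm_seq s) i = s i.
Proof. by rewrite (nth_map i) ?size_enum_ord // nth_ord_enum. Qed.

Lemma one_convex_perm_seq n (s : 'S_n) :
  one_convex s = one_convex_seq (perm_seq s).
Proof.
apply/forallP/one_convex_seqP => [H i|H h].
  rewrite size_perm_seq => lt_i2.
  have lt_i1 := ltnW lt_i2; have lt_i0 := ltnW lt_i1.
  have := H (Ordinal lt_i0) => /forallP/(_ (Ordinal lt_i1)).
  move=> /forallP/(_ (Ordinal lt_i2)); rewrite /= !eqxx /=.
  rewrite -[i in X in _ -> X](_ : nat_of_ord (Ordinal lt_i0) = i) //.
  rewrite -(nth_perm_seq s (Ordinal lt_i0)) -(nth_perm_seq s (Ordinal lt_i1)).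
  rewrite -(nth_perm_seq s (Ordinal lt_i2)) /=; lia.
apply/forallP => i; apply/forallP => j; apply/implyP => /andP[/eqP iE /eqP jE].
have := H h; rewrite size_perm_seq -iE -jE !nth_perm_seq ltn_ord; lia.
Qed.

Lemma perm_seq_inj n : injective (@perm_seq n).
Proof.
move=> s u E; apply/permP => i; apply: val_inj => /=.
by rewrite -!nth_perm_seq E.
Qed.

(** Inclusion and equality of sizes, both [n]!, suffice. *)
Lemma perm_seq_permutations n :
  perm_eq [seq perm_seq s | s : 'S_n] (permutations (iota 0 n)).
Proof.
have U : uniq [seq perm_seq s | s : 'S_n].
  by rewrite map_inj_uniq ?enum_uniq //; apply: perm_seq_inj.
apply: uniq_perm => //; first exact: permutations_uniq.
have sub : {subset [seq perm_seq s | s : 'S_n] <= permutations (iota 0 n)}.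
  move=> _ /mapP[s _ ->]; rewrite mem_permutations -val_enum_ord.
  rewrite /perm_seq (map_comp val s) perm_map //.
  apply: uniq_perm; rewrite ?enum_uniq //.
    by rewrite map_inj_uniq ?enum_uniq //; apply: perm_inj.
  move=> i; rewrite mem_enum; apply/mapP.
  by exists (s^-1%g i); rewrite ?mem_enum ?permKV.
have [] // := uniq_min_size U sub.
rewrite size_permutations ?iota_uniq // size_iota size_map -cardE.
by rewrite card_Sn.
Qed.

Lemma f1_words n : f1 n.+1 = count slow_word (words n).
Proof.
rewrite /f1 cardsE cardE size_filter -(eq_count one_convex_seq_of_word).
transitivity (count one_convex_seq [seq perm_seq s | s : 'S_n.+1]).
  rewrite count_map enumT; apply: eq_count => s.
  exact: one_convex_perm_seq.
rewrite (seq.permP (perm_seq_permutations n.+1)) -size_filter.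
rewrite -(count_map seq_of_word).
rewrite -[RHS]size_filter; apply: perm_size.
apply: uniq_perm; rewrite ?filter_uniq ?permutations_uniq //.
  rewrite map_inj_in_uniq ?uniq_words // => u w.
  rewrite !mem_words => /eqP su /eqP sw; apply: seq_of_word_inj.
  by rewrite su sw.
move=> s; rewrite !mem_filter; case cvx: one_convex_seq => //=.
rewrite mem_permutations; apply/idP/mapP.
  by case/one_convex_seq_word => // w sw ->; exists w; rewrite ?mem_words ?sw.
by case=> w; rewrite mem_words => /eqP <- ->; apply: perm_seq_of_word.
Qed.

Lemma f1_0 : f1 0 = 1.
Proof.
rewrite /f1 -[RHS](fact0) -card_Sn cardsE; apply: eq_card => s.
by rewrite !inE; apply/forallP => -[].
Qed.

(** * Counting walks by their end vertices *)

Section WalkEnds.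
Variables (V : choiceType) (E : rel V) (next : V -> seq V).
Hypothesis uniq_next : forall x, uniq (next x).
Hypothesis mem_next : forall x y, (y \in next x) = E x y.

Fixpoint walk_seq u n : seq (seq V) :=
  if n is m.+1 then [seq rcons p y | p <- walk_seq u m, y <- next (last u p)]
  else [:: [::]].

(** A multiset of ends, one for each walk: it determines both counts, and extending walks by one
    edge requires nothing more. *)
Fixpoint walk_ends u n : seq V :=
  if n is m.+1 then flatten (map next (walk_ends u m)) else [:: u].

Lemma mem_walk_seq u n p :
  (p \in walk_seq u n) = path E u p && (size p == n).
Proof.
elim: n p => [|n IHn] p; first by case: p => //= x p; rewrite andbF.
apply/allpairsPdep/idP => [[r [y]]|].
  rewrite IHn mem_next => -[/andP[r_path /eqP <-] ry ->].
  by rewrite rcons_path r_path ry size_rcons eqxx.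
case/lastP: p => [|p y]; rewrite ?andbF // rcons_path size_rcons eqSS.
case/andP=> /andP[p_path py] sp; exists p, y; split=> //.
  by rewrite IHn p_path.
by rewrite mem_next.
Qed.

Lemma uniq_walk_seq u n : uniq (walk_seq u n).
Proof.
elim: n => //= n IHn; apply: allpairs_uniq_dep => //.
by move=> [p y] [r z] _ _ /= /rcons_inj[-> ->].
Qed.

Lemma walk_endsE u n : walk_ends u n = map (last u) (walk_seq u n).
Proof.
elim: n => //= n ->; rewrite map_flatten -!map_comp; congr flatten.
apply: eq_map => p /=; rewrite -map_comp -[LHS]map_id.
by apply: eq_map => y /=; rewrite last_rcons.
Qed.

Lemma card_walks u n : finite_set (walks E u n) ->
  #|` fset_set (walks E u n)|%fset = size (walk_ends u n).
Proof.
move=> fin; rewrite walk_endsE size_map; apply: perm_size.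
apply: uniq_perm; rewrite ?fset_uniq ?uniq_walk_seq // => p.
rewrite [LHS](in_fset_set fin) mem_walk_seq; apply/idP/andP.
  by rewrite in_setE => -[? /eqP].
by rewrite in_setE => -[? /eqP].
Qed.

Lemma card_walks_to u v n : finite_set (walks_to E u v n) ->
  #|` fset_set (walks_to E u v n)|%fset = count_mem v (walk_ends u n).
Proof.
move=> fin; rewrite walk_endsE count_map -size_filter; apply: perm_size.
apply: uniq_perm; rewrite ?fset_uniq ?filter_uniq ?uniq_walk_seq // => p.
rewrite [LHS](in_fset_set fin) mem_filter mem_walk_seq; apply/idP/and3P => /=.
  by rewrite in_setE => -[[? /eqP ?] /eqP].
by rewrite in_setE => -[/eqP ? ? /eqP].
Qed.

Lemma count_mem_walk_ends u v n :
  count_mem v (walk_ends u n.+1) = count (E^~ v) (walk_ends u n).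
Proof.
rewrite /= count_flatten -sumn_count -map_comp; congr sumn.
by apply: eq_map => x /=; rewrite count_uniq_mem // mem_next.
Qed.

End WalkEnds.

(** * Walks in the digraph T *)

Definition Tnext (x : Tvertex) : seq Tvertex :=
  match x with
  | Main l => Main l.+1 :: (if l is m.+1 then [:: @Mid m ord0] else [::])
  | @Mid l j => if j.+1 < l.+2 then [:: @Mid l (inord j.+1)] else [:: Main l]
  end.

Lemma eq_Main l m : (Main l == Main m) = (l == m).
Proof. by apply/eqP/eqP => [[]|->]. Qed.

Lemma eq_Mid l (j : 'I_l.+2) m (k : 'I_m.+2) :
  (Mid j == Mid k) = (l == m) && (j == k :> nat).
Proof.
apply/eqP/andP => [E|[/eqP lm]].
  have := congr1 (fun x => if x is @Mid a b then (a, val b) else (0, 0)) E.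
  by case=> /eqP -> /eqP.
by case: m / lm k => k /eqP jk; congr Mid; apply: val_inj.
Qed.

Lemma uniq_Tnext x : uniq (Tnext x).
Proof. by case: x => [[|l]|l j] //=; case: ifP. Qed.

Lemma mem_Tnext x y : (y \in Tnext x) = Tedge x y.
Proof.
case: x y => [l|l j] [m|m k] /=.
- by case: l => [|l]; rewrite !inE eq_Main // orbF.
- by case: l => [|l]; rewrite !inE //= eq_Mid eqSS eq_sym.
- case: ltnP => j_l; rewrite inE ?eq_Main.
    by symmetry; apply/negP => /andP[_ /eqP j_eq]; rewrite j_eq ltnn in j_l.
  suff -> : nat_of_ord j = l.+1 by rewrite eqxx andbT eq_sym.
  by apply/eqP; rewrite eqn_leq -ltnS ltn_ord.
- case: ltnP => j_l; rewrite inE ?eq_Mid ?inordK //; first by rewrite eq_sym.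
  symmetry; apply/negP => /andP[/eqP lm /eqP k_eq].
  by have := ltn_ord k; rewrite k_eq -lm ltnNge j_l.
Qed.

Definition Tends n : seq Tvertex := walk_ends Tnext Troot n.

Lemma bot_countE n : bot_count n = count_mem Troot (Tends n).
Proof.
exact: card_walks_to uniq_Tnext mem_Tnext _ _ _ (finite_Twalks_to _ _ _).
Qed.

Lemma tot_countE n : tot_count n = size (Tends n).
Proof. exact: card_walks uniq_Tnext mem_Tnext _ _ (finite_Twalks _ _). Qed.

Definition main_count l n : nat := count_mem (Main l) (Tends n).

Lemma count_mem_TendsS x n :
  count_mem x (Tends n.+1) = count (Tedge^~ x) (Tends n).
Proof. exact: count_mem_walk_ends uniq_Tnext mem_Tnext _ _ _. Qed.

(** A return path can be entered only at its start, so a walk ending at [Mid j] was at [Main l.+1]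
    exactly [j.+1] steps earlier. *)
Lemma Mid_count l (j : 'I_l.+2) n :
  count_mem (Mid j) (Tends n) = if n <= j then 0 else main_count l.+1 (n - j.+1).
Proof.
case: j => j lt_j /=; elim: j lt_j n => [|j IHj] lt_j [|n] //=.
  rewrite count_mem_TendsS subn1; apply: eq_count => -[m|m k] /=.
    by rewrite eq_Main andbT.
  by rewrite andbF.
rewrite count_mem_TendsS -(IHj (ltnW lt_j)); apply: eq_count => -[m|m k] /=.
  by rewrite andbF.
by rewrite eq_Mid eqSS; congr (_ && _); rewrite eq_sym.
Qed.

Lemma main_count0 n :
  main_count 0 n.+1 = if n <= 1 then 0 else main_count 1 (n - 2).
Proof.
rewrite -(@Mid_count 0 ord_max) /main_count count_mem_TendsS.
apply: eq_count => -[m|m k] //=.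
by rewrite eq_Mid; case: eqP => //= ml; congr (nat_of_ord k == _.+1).
Qed.

Lemma main_countS l n : main_count l.+1 n.+1 =
  main_count l n + if n <= l.+2 then 0 else main_count l.+2 (n - l.+3).
Proof.
rewrite -(@Mid_count l.+1 ord_max) /main_count count_mem_TendsS.
rewrite -count_predUI [X in _ + X](_ : _ = 0) ?addn0; last first.
  by apply/eqP; rewrite -leqn0 leqNgt -has_count; apply/hasPn => -[m|m k] _ /=;
    rewrite ?andbF //=.
apply: eq_count => -[m|m k] /=.
  by rewrite eq_Main orbF eqSS eq_sym.
by rewrite eq_Mid; case: eqP => //= ml; congr (nat_of_ord k == _.+1).
Qed.

(** A variable threshold lets main vertices be split off one at a time, leaving a remainder that
    vanishes up to any given length. *)
Definition high k : pred Tvertex :=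
  fun x => if x is Main l then k <= l else false.

Lemma count_high k n :
  count (high k) (Tends n) = main_count k n + count (high k.+1) (Tends n).
Proof.
rewrite /main_count -count_predUI [X in _ + X](_ : _ = 0) ?addn0; last first.
  apply/eqP; rewrite -leqn0 leqNgt -has_count; apply/hasPn => -[m|m j] _ //=.
  by rewrite eq_Main; case: eqP => // ->; rewrite ltnn.
by apply: eq_count => -[m|m j] //=; rewrite eq_Main leq_eqVlt eq_sym.
Qed.

Lemma count_high_eq0 k n : n < k -> count (high k) (Tends n) = 0.
Proof.
suff bound x : x \in Tends n ->
    (match x with Main l => l | @Mid l _ => l end) <= n.
  move=> lt_nk; apply/eqP; rewrite -leqn0 leqNgt -has_count.
  apply/hasPn => -[l|l j] //= /bound /= le_ln.
  by rewrite -ltnNge (leq_ltn_trans le_ln).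
elim: n x => [|n IHn] x; first by rewrite inE => /eqP ->.
case/flatten_mapP => y /IHn; rewrite mem_Tnext;
  case: y x => [l|l j] [m|m i] //=.
- by move=> le /eqP ->.
- by move=> le /andP[/eqP lE _]; rewrite lE in le; apply: leqW (ltnW le).
- by move=> le /andP[/eqP lm _]; rewrite -lm; apply: leqW.
- by move=> le /andP[/eqP lm _]; rewrite -lm; apply: leqW.
Qed.

(* The vertices of out-degree 2 are the main vertices other than the root. *)
Lemma tot_countS n : tot_count n.+1 = tot_count n + count (high 1) (Tends n).
Proof.
rewrite !tot_countE /Tends /= size_flatten /shape -map_comp.
elim: (walk_ends _ _ _) => //= x s ->.
suff -> : size (Tnext x) = (high 1 x).+1 by lia.
by case: x => [[|l]|l j] //=; case: ifP.
Qed.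

(** * Generating functions of the words *)

Local Open Scope ring_scope.

Lemma fpsnth_Xmul (R : comNzRingType) (a : {fps R}) n :
  fpsnth (fpsX * a) n = if n is m.+1 then fpsnth a m else 0.
Proof.
rewrite fpsnthM; case: n => [|n]; first by rewrite big_ord1 mul0r.
rewrite !big_ord_recl /= mul0r add0r mul1r subn1 big1 ?addr0 // => i _.
by rewrite mul0r.
Qed.

Lemma fpsnth_Xnmul (R : comNzRingType) k (a : {fps R}) n :
  fpsnth (fpsX ^+ k * a) n = if (n < k)%N then 0 else fpsnth a (n - k).
Proof.
elim: k n => [|k IHk] n; first by rewrite mul1r subn0.
by rewrite exprS -mulrA fpsnth_Xmul; case: n => // n; rewrite IHk.
Qed.

Local Notation q := (fpsX : {fps int}).
Local Notation "a `_[ n ]" := (fpsnth a n) (at level 3, format "a `_[ n ]").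

Definition after_gf p t v : {fps int} := gf (cnt_after p t v).

Lemma after_gf_rec p t v : slow p t.+1 ->
  after_gf p t v = 1 + q * after_gf v 1 t.+1 + q * after_gf p t.+1 1.
Proof.
move=> pt; apply/fpsP => -[|n]; rewrite !fpsnthD !fpsnth_Xmul /= pt.
  by rewrite !addr0.
by rewrite mul1n natrD add0r.
Qed.

(** The pending gap of the other letter can only grow, and even the end of the word closes it. *)
Lemma after_gf_eq0 p t v : ~~ slow p t.+1 -> after_gf p t v = 0.
Proof.
move=> pt; apply/fpsP => n /=; apply/eqP.
rewrite (_ : cnt_after _ _ _ _ = 0%N) //.
elim: n t v pt => [|n IHn] t v pt /=; rewrite (negbTE pt) //.
by rewrite mul0n add0n IHn //; move: pt; rewrite /slow; lia.
Qed.

(* The continuations of a run of length [k] preceded by a run of length 1 and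
   followed by the other letter or the end; for [k >= 2] the run is indeed
   followed by a run of length 1. *)
Definition run_gf k : {fps int} := 1 + q * after_gf 1 1 k.+1.

Definition tail p t : {fps int} := after_gf p t 1.

Lemma tail_rec p t : slow p t.+1 -> tail p t = run_gf t + q * tail p t.+1.
Proof. exact: after_gf_rec. Qed.

(** For [0 < p], [tail p t] unrolls to the sum of [q ^+ (j - t) * run_gf j] over [t <= j <= p]; a
    larger [p] adds one term. *)
Lemma tail_diff p d : (d <= p)%N ->
  tail p.+2 (p.+2 - d) - tail p.+1 (p.+2 - d) = q ^+ d * run_gf p.+2.
Proof.
elim: d => [|d IHd] le_dp.
  rewrite subn0 tail_rec /slow ?leqnn // /tail !after_gf_eq0 /slow; try lia.
  by rewrite mulr0 mul1r subr0 addr0.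
rewrite (@tail_rec p.+2 (_ - _.+1)) 1?(@tail_rec p.+1 (_ - _.+1));
  try by rewrite /slow; lia.
rewrite (_ : (p.+2 - d.+1).+1 = p.+2 - d)%N; last by lia.
by rewrite exprS -mulrA -IHd 1?ltnW //; ring.
Qed.

Lemma after_gf12 p : after_gf p 1 2 = after_gf 1 1 2 + q * tail p 2.
Proof.
rewrite after_gf_rec; last by rewrite /slow; lia.
by rewrite (@after_gf_rec 1) // (@after_gf_eq0 1) // mulr0 addr0.
Qed.

Lemma run_gfE k : run_gf k = 1 + q + q ^+ 2 * (after_gf 1 1 2 + q * tail k.+1 2).
Proof.
rewrite /run_gf after_gf_rec // (@after_gf_eq0 1 2) // after_gf12 //.
by rewrite mulr0 addr0; ring.
Qed.

(** The formal length 0 turns [run_gf_rec 0] into a relation between [run_gf 1] and [run_gf 2]. *)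
Lemma run_gf0 : run_gf 0 = 1 + q * run_gf 1.
Proof.
by rewrite {1}/run_gf after_gf_rec // (@after_gf_eq0 1 2) // mulr0 addr0.
Qed.

Lemma run_gf_rec k : run_gf k.+1 = run_gf k + q ^+ k.+3 * run_gf k.+2.
Proof.
rewrite (run_gfE k.+1) (run_gfE k).
have -> : tail k.+2 2 = tail k.+1 2 + q ^+ k * run_gf k.+2.
  rewrite -(@tail_diff k k) // (_ : k.+2 - k = 2)%N; first by ring.
  by lia.
by rewrite !exprS; ring.
Qed.

(** The factor [1 - q] absorbs the initial run, whose length is unrestricted. *)
Lemma cnt_first_gf :
  (1 - q) * gf (cnt_first 0) = 1 + q * run_gf 1 + q ^+ 2 * tail 0 2.
Proof.
have rec v : gf (cnt_first v) = 1 + q * after_gf v 1 0 + q * gf (cnt_first 1).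
  apply/fpsP => -[|n]; rewrite !fpsnthD !fpsnth_Xmul /= ?addr0 //.
  by rewrite natrD add0r.
have rec1 : (1 - q) * gf (cnt_first 1) = 1 + q * after_gf 1 1 0.
  by rewrite mulrBl mul1r {1}rec; ring.
have X012 : after_gf 0 1 2 = after_gf 1 1 2 + q * tail 0 2.
  exact: after_gf12.
have X010 : after_gf 0 1 0 = 1 + q * after_gf 0 1 2 + q * tail 0 2.
  exact: after_gf_rec.
have X110 : after_gf 1 1 0 = 1 + q * after_gf 0 1 2.
  by rewrite after_gf_rec // (@after_gf_eq0 1 2) // mulr0 addr0.
rewrite rec mulrDr mulrCA rec1 X010 X110 X012 /run_gf; ring.
Qed.

(** * Generating functions of the walks, compared with those of the words *)

Definition main_gf l : {fps int} := gf (main_count l).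

Lemma main_gf0 : main_gf 0 = 1 + q ^+ 3 * main_gf 1.
Proof.
apply/fpsP => n; rewrite fpsnthD fpsnth_Xnmul fpsnth1 /=.
case: n => [|n]; first by rewrite /main_count /= addr0.
by rewrite main_count0 add0r !ltnS subSS; case: ifP.
Qed.

Lemma main_gfS l : main_gf l.+1 = q * main_gf l + q ^+ l.+4 * main_gf l.+2.
Proof.
apply/fpsP => n; rewrite fpsnthD fpsnth_Xnmul fpsnth_Xmul /=.
case: n => [|n]; first by rewrite /main_count /= addr0.
by rewrite main_countS natrD !ltnS subSS; case: ifP.
Qed.

(* Both sides satisfy the recurrence of [main_gf] with the source multiplied by
   [run_gf 1]; every other term of it has a factor [q], so the solution is
   unique. *)
Lemma run_gf1_main_gf l : run_gf 1 * main_gf l = q ^+ l * run_gf l.+2.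
Proof.
pose Z l := run_gf 1 * main_gf l - q ^+ l * run_gf l.+2.
have Z0 : Z 0%N = q ^+ 3 * Z 1%N.
  rewrite /Z main_gf0 (run_gf_rec 1) !exprS expr0; ring.
have ZS k : Z k.+1 = q ^+ 1 * Z k + q ^+ k.+4 * Z k.+2.
  rewrite /Z main_gfS (run_gf_rec k.+2) !exprS expr0; ring.
suff : Z l = 0 by move/eqP; rewrite subr_eq0 => /eqP.
apply/fpsP => n; rewrite [RHS](_ : _ = 0) //.
elim/ltn_ind: n l => n IHn [|l].
  by rewrite Z0 fpsnth_Xnmul; case: ltnP => // le; rewrite IHn //; lia.
rewrite ZS fpsnthD !fpsnth_Xnmul.
case: (ltnP n 1) => ?; case: ltnP => ?; rewrite ?IHn ?addr0 //; lia.
Qed.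

Definition high_gf k : {fps int} := gf (fun n => count (high k) (Tends n)).

(** This is [run_gf1_main_gf] summed over all [l >= k]: as gap 0 imposes no bound, [tail 0 t] is the
    infinite sum of [q ^+ (j - t) * run_gf j] over [j >= t]. *)
Lemma run_gf1_high_gf k : run_gf 1 * high_gf k = q ^+ k * tail 0 k.+2.
Proof.
pose Z k := run_gf 1 * high_gf k - q ^+ k * tail 0 k.+2.
(* [Z] is constant, while [Z j] has no coefficient below degree [j]; hence it is 0. *)
have ZS j : Z j = Z j.+1.
  have -> : Z j = run_gf 1 * main_gf j + run_gf 1 * high_gf j.+1
      - q ^+ j * tail 0 j.+2.
    rewrite /Z -mulrDr; congr (_ * _ - _); apply/fpsP => n.
    by rewrite fpsnthD /= count_high natrD.
  by rewrite run_gf1_main_gf tail_rec // /Z exprS; ring.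
have val j n : (n < j)%N -> (Z j)`_[n] = 0.
  move=> lt_nj; rewrite fpsnthD fpsnthN fpsnth_Xnmul lt_nj oppr0 addr0 fpsnthM.
  by apply: big1 => i _; rewrite /= count_high_eq0 ?mulr0 //; lia.
suff : Z k = 0 by move/eqP; rewrite subr_eq0 => /eqP.
apply/fpsP => n; rewrite [RHS](_ : _ = 0) // -(@val (n.+1 + k)%N n) ?leq_addr //.
by elim: n.+1 => [|m IHm] //; rewrite addSn -ZS.
Qed.

(** * Assembling the formula *)

Lemma f1_gf : gf f1 = 1 + q + 2 * q ^+ 2 * gf (cnt_first 0).
Proof.
apply/fpsP => -[|[|n]]; rewrite !fpsnthD -mulrA mulr_natl mulr2n fpsnthD;
  rewrite !fpsnth_Xnmul.
- by rewrite /= f1_0 !addr0.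
- by rewrite /= f1_words /= !addr0 add0r.
- by rewrite /= f1_words count_slow_word -addnn natrD !add0r subn2.
Qed.

Theorem mainTheorem6 :
  let q : {fps int} := fpsX in
  let F1 := gf f1 in
  let bot := gf bot_count in
  let tot := gf tot_count in
  F1 = 1 + q - 2 * q ^+ 2 * ((1 + bot * q ^+ 2 + tot * q)
                             / (- 1 + q + bot * q ^+ 3)).
Proof.
cbv zeta; set bot := gf bot_count; set tot := gf tot_count.
have run_gf1_bot : run_gf 1 * bot = run_gf 2.
  rewrite -[RHS]mul1r -(run_gf1_main_gf 0); congr (_ * _); apply/fpsP => n /=.
  by rewrite bot_countE.
(* The denominator is inverted by [- run_gf 1], so the division becomes a product. *)
have run_gf1_inv : (- 1 + q + bot * q ^+ 3) * - run_gf 1 = 1.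
  have recE := run_gf_rec 0; rewrite run_gf0 in recE.
  have -> : (- 1 + q + bot * q ^+ 3) * - run_gf 1 =
      run_gf 1 - q * run_gf 1 - q ^+ 3 * (run_gf 1 * bot).
    ring.
  by rewrite run_gf1_bot {1}recE; ring.
have tot_rec : (1 - q) * tot = 1 + q * high_gf 1.
  have E : tot = 1 + q * tot + q * high_gf 1.
    apply/fpsP => -[|n]; rewrite !fpsnthD !fpsnth_Xmul /=.
      by rewrite tot_countE !addr0.
    by rewrite tot_countS natrD add0r.
  by rewrite mulrBl mul1r {1}E; ring.
have run_gf1_tot : (1 - q) * (run_gf 1 * tot) = run_gf 1 + q ^+ 2 * tail 0 3.
  rewrite mulrCA tot_rec mulrDr mulr1 mulrCA run_gf1_high_gf; ring.
have unit_1q : 1 - q \is a GRing.unit.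
  by rewrite fps_unitE fpsnthD fpsnthN /= subr0 unitr1.
set D := - 1 + q + bot * q ^+ 3 in run_gf1_inv *.
have U : D \is a GRing.unit by apply/unitrPr; exists (- run_gf 1).
have -> : D^-1 = - run_gf 1 by apply: (mulrI U); rewrite divrr.
rewrite f1_gf !mulrN opprK; congr (_ + _ * _).
apply: (mulrI unit_1q); rewrite cnt_first_gf.
have -> : (1 - q) * ((1 + bot * q ^+ 2 + tot * q) * run_gf 1) =
  (1 - q) * (run_gf 1 + q ^+ 2 * (run_gf 1 * bot)) +
  q * ((1 - q) * (run_gf 1 * tot)) by ring.
(* Once [tail 0 2] is expressed by [tail 0 3], the two sides differ only by [run_gf 1 = 1 + q *
   run_gf 1 + q ^+ 3 * run_gf 2]. *)
rewrite run_gf1_bot run_gf1_tot tail_rec //.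
have recE := run_gf_rec 0; rewrite run_gf0 in recE.
by rewrite {2 3}recE; ring.
Qed.
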